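(* For all integers $a,b,m\geq 1$, \[\sum_{\tau \in \mathcal{PP}^{+1}_m(a\times b)} q^{|\tau|-1} = \frac{[a]_q[b]_q}{[a+b]_q} \cdot [m]_q \cdot \sum_{\pi \in \mathcal{PP}_m(a\times b)} q^{|\pi|}\] as an identity of polynomials in $q$.
   Context: $[k]_q=1+q+\cdots+q^{k-1}$. An $a\times b$ plane partition with entries in $\{0,\dots,m\}$ is an $a\times b$ array of integers in $\{0,1,\dots,m\}$ weakly decreasing along rows (left to right) and down columns; $\mathcal{PP}_m(a\times b)$ is their set and $|\pi|$ is the sum of the entries. A barely set-valued $a\times b$ plane partition with entries in $\{0,\dots,m\}$ is an assignment $\tau$ of a nonempty subset $\tau(u)\subseteq\{0,1,\dots,m\}$ to each box $u$ of the $a\times b$ array such that exactly one box gets a two-element set and all others get one-element sets, and $\min\tau(u)\geq \max\tau(v)$ whenever $u\neq v$ and $u$ is weakly northwest of $v$ (i.e., weakly above and weakly to the left). $\mathcal{PP}^{+1}_m(a\times b)$ is their set, and $|\tau|=\sum_u\sum_{i\in\tau(u)} i$. *)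

(* Defs.v *)
From HB Require Import structures.
From mathcomp Require Import all_boot all_order all_algebra.

Set Implicit Arguments.
Unset Strict Implicit.
Unset Printing Implicit Defensive.

Import Order.TTheory GRing.Theory Num.Theory.

Section PlanePartitions.

Variables a b m : nat.

(* (i, j) is the box in row i, from the top, and column j, from the left. *)
Definition is_pp (p : {ffun 'I_a * 'I_b -> 'I_m.+1}) : bool :=
  [forall i : 'I_a, forall j : 'I_b, forall j' : 'I_b,
     (j <= j') ==> (p (i, j') <= p (i, j))] &&
  [forall j : 'I_b, forall i : 'I_a, forall i' : 'I_a,
     (i <= i') ==> (p (i', j) <= p (i, j))].

Definition PP : {set {ffun 'I_a * 'I_b -> 'I_m.+1}} := [set p | is_pp p].

Definition pp_size (p : {ffun 'I_a * 'I_b -> 'I_m.+1}) : nat :=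
  \sum_(u : 'I_a * 'I_b) p u.

Definition northwest (u v : 'I_a * 'I_b) : bool :=
  (u.1 <= v.1) && (u.2 <= v.2).

(* These are the minimum and the maximum only for nonempty A; see set_minP and
   set_maxP. *)
Definition set_min (A : {set 'I_m.+1}) : nat := \big[minn/m]_(i in A) (i : nat).
Definition set_max (A : {set 'I_m.+1}) : nat := \max_(i in A) (i : nat).

Definition barely (t : {ffun 'I_a * 'I_b -> {set 'I_m.+1}}) : bool :=
  [exists u : 'I_a * 'I_b,
     (#|t u| == 2) && [forall v, (v != u) ==> (#|t v| == 1)]].

Definition is_bsv_pp (t : {ffun 'I_a * 'I_b -> {set 'I_m.+1}}) : bool :=
  [&& [forall u, t u != set0],
      barely t
    & [forall u, forall v,
         (u != v) && northwest u v ==> (set_max (t v) <= set_min (t u))]].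

Definition PP1 : {set {ffun 'I_a * 'I_b -> {set 'I_m.+1}}} :=
  [set t | is_bsv_pp t].

Definition bsv_size (t : {ffun 'I_a * 'I_b -> {set 'I_m.+1}}) : nat :=
  \sum_(u : 'I_a * 'I_b) \sum_(i in t u) (i : nat).

Lemma set_minP (A : {set 'I_m.+1}) : A != set0 ->
  (exists2 i, i \in A & set_min A = i) /\ (forall i, i \in A -> set_min A <= i).
Proof.
have lb i : i \in A -> set_min A <= i.
  move=> iA; rewrite /set_min; elim: (index_enum _) (mem_index_enum i) => //.
  move=> x s IHs; rewrite inE big_cons => /predU1P[<-|/IHs le_i].
    by rewrite iA geq_minl.
  by case: ifP => // _; rewrite geq_min le_i orbT.
case/set0Pn=> x xA; split=> //.
have : set_min A = m \/ exists2 i, i \in A & set_min A = i.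
  rewrite /set_min.
  elim/big_ind: _ => [|y z Hy Hz|i iA]; [by left| |by right; exists i].
  by case: (leqP y z).
case=> [eqm|//]; exists x => //.
by apply/eqP; rewrite eqn_leq lb // eqm -ltnS ltn_ord.
Qed.

Lemma set_maxP (A : {set 'I_m.+1}) : A != set0 ->
  (exists2 i, i \in A & set_max A = i) /\ (forall i, i \in A -> i <= set_max A).
Proof.
case/set0Pn=> x xA; split; last by move=> i iA; apply: leq_bigmax_cond.
have [|i iA eq_i] := @eq_bigmax_cond _ (mem A) (fun i => nat_of_ord i).
  by apply/card_gt0P; exists x.
by exists i => //; rewrite -eq_i.
Qed.

(* Hence the truncated subtraction in the exponent bsv_size t - 1 is harmless. *)
Lemma bsv_size_gt0 t : t \in PP1 -> 0 < bsv_size t.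
Proof.
rewrite inE => /and3P[_ /existsP[u /andP[/cards2P[x [y [xy tu]]] _]] _].
rewrite /bsv_size (bigD1 u) //= tu big_setU1 ?inE //= big_set1.
apply: leq_trans (leq_addr _ _); rewrite addn_gt0 !lt0n -negb_and.
apply: contra xy => /andP[/eqP x0 /eqP y0].
by apply/eqP/val_inj; rewrite /= x0 y0.
Qed.

End PlanePartitions.

Local Open Scope ring_scope.

Notation "x %:F" := (@FracField.tofrac _ x) : ring_scope.

Definition qint (k : nat) : {poly int} := \sum_(i < k) 'X^i.

(* Main.v *)
Require Import Defs.
From HB Require Import structures.
From mathcomp Require Import all_boot all_order all_algebra.
From mathcomp Require Import ring zify.

Set Implicit Arguments.
Unset Strict Implicit.
Unset Printing Implicit Defensive.

Import Order.TTheory GRing.Theory Num.Theory.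
Local Open Scope ring_scope.

(* A barely set-valued plane partition whose exceptional box [u] holds [x < y]
   is a plane partition [p] (keep [x] at [u]) together with a level [y] such
   that [u] can be added to the order ideal [I_y = {v | p v >= y}].  So the left
   side counts addable boxes of order ideals [I], each [I = I_y] weighted by
   [q^(|p| + y - 1)].  Keeping [y] at [u] instead shows that, under these
   weights, a given [u] is removable exactly [q] times as often as it is addable.

   Let [H i j] be [corner_wt], the function of the form [alpha i + beta j] that
   vanishes at the top right and bottom left corners of the [a x b] rectangle and
   for which [H i j - q * H i.+1 j.+1] is the constant [(1-q)(1-q^(a+b))].
   Telescoping along the boundary of an ideal, the sum of [H] over its outer
   corners minus the sum over its inner corners is always [(1-q^a)(1-q^b)].
   Averaging over ideals, the [q]-symmetry collapses the left side to
   [(1-q)(1-q^(a+b))] times the number of addable boxes. *)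

(** * The corner weight and its telescoping sum along a boundary *)

Section CornerSum.

Variables (R : comPzRingType) (q : R) (a b : nat).

(** The lattice points that occur satisfy [i <= a] and [j <= b], so both truncated subtractions are
    exact. *)
Definition corner_wt (i j : nat) : R :=
  (1 - q ^+ (a + b)) - q ^+ (a - i) * (1 - q ^+ b) - q ^+ (b - j) * (1 - q ^+ a).

Lemma corner_wt_diag i j : (i < a)%N -> (j < b)%N ->
  corner_wt i j - q * corner_wt i.+1 j.+1 = (1 - q) * (1 - q ^+ (a + b)).
Proof.
move=> ia jb; rewrite /corner_wt.
rewrite -[(a - i)%N]prednK ?subn_gt0 // -subnS -[(b - j)%N]prednK ?subn_gt0 //.
by rewrite -subnS !exprS; ring.
Qed.

Lemma corner_wt_topright : corner_wt 0 b = 0.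
Proof. by rewrite /corner_wt subn0 subnn exprD expr0; ring. Qed.

Lemma corner_wt_bottomleft : corner_wt a 0 = 0.
Proof. by rewrite /corner_wt subn0 subnn exprD expr0; ring. Qed.

Lemma sum_ord_eq (n k : nat) (F : nat -> R) (P : bool) :
  \sum_(j < n | (j == k :> nat) && P) F j = if (k < n)%N && P then F k else 0.
Proof.
have [kn|nk] /= := ltnP k n; last first.
  by rewrite big_pred0 // => j; have := ltn_ord j; case: eqP => //= ->; lia.
case: P => /=; last by rewrite big_pred0 // => j; rewrite andbF.
rewrite (eq_bigl (pred1 (Ordinal kn))) ?big_pred1_eq // => j.
by rewrite /= andbT -val_eqE.
Qed.

(* Here [mu i.+1] is the length of row [i] of a Young diagram in the [a x b]
   box; the convention [mu 0 = b], [mu a.+1 = 0] frames the diagram. *)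
Lemma corner_sum (mu : nat -> nat) :
    mu 0 = b -> mu a.+1 = 0%N -> (forall i, mu i.+1 <= mu i)%N ->
  \sum_(i < a) \sum_(j < b | (j == mu i.+1 :> nat) && (mu i.+1 < mu i)%N)
      corner_wt i j -
  \sum_(i < a) \sum_(j < b | (j.+1 == mu i.+1 :> nat) && (mu i.+2 < mu i.+1)%N)
      corner_wt i.+1 j.+1 =
  (1 - q ^+ a) * (1 - q ^+ b).
Proof.
move=> mu0 mua muS.
have lb i : (mu i <= b)%N.
  by elim: i => [|i]; [rewrite mu0 | apply: leq_trans].
(* Both kinds of corner are read at height [i]: the outer one is [(i, mu i.+1)] and, after an index
   shift, the inner one is [(i, mu i)], under the same condition. *)
pose e i := if (mu i.+1 < mu i)%N then corner_wt i (mu i.+1) else 0.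
pose f i := if (mu i.+1 < mu i)%N then corner_wt i (mu i) else 0.
rewrite (eq_bigr (fun i : 'I_a => e i)) => [|i _]; last first.
  rewrite sum_ord_eq /e; case: ltnP => //= b_le.
  by case: ltnP => // lt_mu; have := lb i; lia.
rewrite [X in _ - X](eq_bigr (fun i : 'I_a => f i.+1)) => [|i _]; last first.
  rewrite /f; case E: (mu i.+1) => [|l]; first by rewrite ltn0 big_pred0.
  under eq_bigl do rewrite eqSS.
  rewrite (sum_ord_eq _ _ (fun j => corner_wt i.+1 j.+1)).
  by have := lb i.+1; rewrite E => ->.
(* The extra terms that bring both sums to the range [0..a] sit at the bottom left and top right
   corners, where the weight vanishes. *)
have ea : e a = 0 by rewrite /e mua corner_wt_bottomleft if_same.
have f0 : f 0%N = 0 by rewrite /f mu0 corner_wt_topright if_same.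
have -> : \sum_(i < a) e i = \sum_(i < a.+1) e i.
  by rewrite big_ord_recr /= ea addr0.
have -> : \sum_(i < a) f i.+1 = \sum_(i < a.+1) f i.
  by rewrite big_ord_recl /= f0 add0r.
rewrite -sumrB.
(* At equal height the row parts cancel; [g] is the column part that remains, and it telescopes. *)
pose g i := - (q ^+ (b - mu i) * (1 - q ^+ a)).
rewrite (eq_bigr (fun i : 'I_a.+1 => g i.+1 - g i)) => [|i _].
  rewrite -(big_mkord xpredT (fun i => g i.+1 - g i)) telescope_sumr //.
  by rewrite /g mua mu0 subn0 subnn expr0; ring.
rewrite /e /f /g /corner_wt; case: ltnP (muS i) => h1 h2; first by ring.
have -> : mu i = mu i.+1 by lia.
by rewrite !subrr.
Qed.

End CornerSum.

(** * Addable and removable boxes of order ideals *)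

(** A downward closed [P] is an initial segment: it contains the [j.+1] elements up to [j] if [P j],
    and otherwise lies among the [j] elements below. *)
Lemma ltn_card_antitone (b : nat) (P : pred 'I_b) (j : 'I_b) :
  (forall j1 j2 : 'I_b, (j1 <= j2)%N -> P j2 -> P j1) -> (j < #|P|)%N = P j.
Proof.
move=> anti.
have cardlt n : (n <= b)%N -> #|[pred i : 'I_b | (i < n)%N]| = n.
  by move=> nb; rewrite -sum1_card -(big_ord_widen _ (fun=> 1%N)) ?sum1_card ?card_ord.
have jb := ltn_ord j.
apply/idP/idP => [|Pj]; last first.
  rewrite -[j.+1]cardlt //; apply/subset_leq_card/subsetP => i.
  by rewrite !inE ltnS => ij; apply: anti ij Pj.
apply: contraTT => nPj; rewrite -leqNgt -[leqRHS](cardlt _ (ltnW jb)).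
apply/subset_leq_card/subsetP => i Pi; rewrite inE /= ltnNge.
by apply: contra nPj => ji; apply: anti ji Pi.
Qed.

Section Corners.

Variables a b m : nat.
Local Notation box := ('I_a * 'I_b)%type.
Local Notation filling := {ffun box -> 'I_m.+1}.

Implicit Types (p : filling) (u v w : box).

Lemma PP_monoP p :
  reflect (forall u v, northwest u v -> (p v <= p u)%N) (p \in PP a b m).
Proof.
rewrite inE; apply: (iffP andP) => [[/forallP h1 /forallP h2] [i j] [i' j']|h].
  move=> /andP[/= ii jj]; apply: (@leq_trans (p (i, j'))).
    by have /forallP/(_ i)/forallP/(_ i')/implyP := h2 j'; apply.
  by have /forallP/(_ j)/forallP/(_ j')/implyP := h1 i; apply.
split; apply/forallP => x; apply/forallP => y; apply/forallP => z; apply/implyP.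
  by move=> yz; apply: h; rewrite /northwest /= leqnn.
by move=> yz; apply: h; rewrite /northwest /= leqnn yz.
Qed.

(* [u] can be added to the order ideal of the boxes with entry at least [y]. *)
Definition addable p (y : nat) u : bool :=
  (p u < y)%N && [forall v, (v != u) && northwest v u ==> (y <= p v)%N].

(* [u] can be removed from the order ideal of the boxes with entry above [x]. *)
Definition removable p (x : nat) u : bool :=
  (x < p u)%N && [forall v, (v != u) && northwest u v ==> (p v <= x)%N].

Lemma addableP p y u :
  reflect ((p u < y)%N /\ forall v, v != u -> northwest v u -> (y <= p v)%N)
          (addable p y u).
Proof.
apply: (iffP andP) => [[-> /forallP h]|[-> h]]; split=> //.
  by move=> v vu nw; apply: (implyP (h v)); rewrite vu.
by apply/forallP => v; apply/implyP => /andP[]; apply: h.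
Qed.

Lemma removableP p x u :
  reflect ((x < p u)%N /\ forall v, v != u -> northwest u v -> (p v <= x)%N)
          (removable p x u).
Proof.
apply: (iffP andP) => [[-> /forallP h]|[-> h]]; split=> //.
  by move=> v vu nw; apply: (implyP (h v)); rewrite vu.
by apply/forallP => v; apply/implyP => /andP[]; apply: h.
Qed.

(** * Detailed balance between addition and removal *)

Definition swap_entry u (z : filling * 'I_m.+1) : filling * 'I_m.+1 :=
  ([ffun v => if v == u then z.2 else z.1 v], z.1 u).

Lemma swap_entryK u : involutive (swap_entry u).
Proof.
case=> p y; rewrite /swap_entry /= ffunE eqxx; congr pair.
by apply/ffunP => v; rewrite !ffunE; case: eqP => // ->.
Qed.

(** Each side's monotonicity at [u] supplies the other side's corner condition, and conversely: the
    two numbers [p u < y] both fit between the entries northwest and southeast of [u]. *)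
Lemma addable_swap u (z : filling * 'I_m.+1) :
  (z.1 \in PP a b m) && addable z.1 z.2 u =
  ((swap_entry u z).1 \in PP a b m) &&
    removable (swap_entry u z).1 (swap_entry u z).2 u.
Proof.
case: z => p y; rewrite /swap_entry /=.
apply/idP/idP => [/andP[/PP_monoP pp /addableP[lt_y le_y]]|].
  apply/andP; split.
    apply/PP_monoP => v w nw; rewrite !ffunE.
    case: (eqVneq w u) nw => [->|wu]; case: (eqVneq v u) => [->|vu] // nw.
    - exact: le_y.
    - exact: leq_trans (pp _ _ nw) (ltnW lt_y).
    - exact: pp.
  apply/removableP; rewrite !ffunE eqxx; split=> // v vu nw.
  by rewrite ffunE (negPf vu) pp.
case/andP=> /PP_monoP pp /removableP[]; rewrite !ffunE eqxx => lt_y le_p.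
apply/andP; split.
  apply/PP_monoP => v w nw.
  case: (eqVneq w u) nw => [->|wu]; case: (eqVneq v u) => [->|vu] // nw.
  - have := pp _ _ nw; rewrite !ffunE eqxx (negPf vu).
    by apply: leq_trans; apply: ltnW.
  - by have := le_p w wu nw; rewrite ffunE (negPf wu).
  - by have := pp _ _ nw; rewrite !ffunE (negPf wu) (negPf vu).
apply/addableP; split=> // v vu nw.
by have := pp _ _ nw; rewrite !ffunE eqxx (negPf vu).
Qed.

Lemma pp_size_swap u (z : filling * 'I_m.+1) :
  (pp_size (swap_entry u z).1 + (swap_entry u z).2 = pp_size z.1 + z.2)%N.
Proof.
case: z => p y; rewrite /swap_entry /pp_size /= (bigD1 u) //= ffunE eqxx.
rewrite [in RHS](bigD1 u) //= (eq_bigr (fun v => p v : nat)); first by lia.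
by move=> v vu; rewrite ffunE (negPf vu).
Qed.

(* Detailed balance between adding and removing [u]: exchange the entry of [u]
   with the level of the order ideal. *)
Lemma sum_addable_removable (R : pzRingType) (q : R) u :
  \sum_(z : filling * 'I_m.+1 | (z.1 \in PP a b m) && addable z.1 z.2 u)
     q ^+ (pp_size z.1 + z.2) =
  \sum_(z : filling * 'I_m.+1 | (z.1 \in PP a b m) && removable z.1 z.2 u)
     q ^+ (pp_size z.1 + z.2).
Proof.
rewrite [RHS](reindex_inj (can_inj (swap_entryK u))) /=.
by apply: eq_big => z; [exact: addable_swap | rewrite -(pp_size_swap u z)].
Qed.

(** * Corners in terms of row lengths *)

(* Framed as in [corner_sum]: row [i] has length [rowlen p k i.+1]. *)
Definition rowlen p (k i : nat) : nat :=
  if i is i'.+1 then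
    if insub i' is Some r then #|[pred j : 'I_b | (k < p (r, j))%N]| else 0%N
  else b.

Lemma rowlenE p k (i : 'I_a) : rowlen p k i.+1 = #|[pred j : 'I_b | (k < p (i, j))%N]|.
Proof. by rewrite /rowlen valK. Qed.

Lemma rowlen_last p k : rowlen p k a.+1 = 0%N.
Proof. by rewrite /rowlen insubN // ltnn. Qed.

Lemma ltn_rowlen p k (i : 'I_a) (j : 'I_b) :
  p \in PP a b m -> (j < rowlen p k i.+1)%N = (k < p (i, j))%N.
Proof.
move=> /PP_monoP pp; rewrite rowlenE ltn_card_antitone // => j1 j2 j12 /= /leq_trans.
by apply; apply: pp; rewrite /northwest /= leqnn.
Qed.

Lemma rowlen_anti p k i : p \in PP a b m -> (rowlen p k i.+1 <= rowlen p k i)%N.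
Proof.
move=> pPP; have [ia|ai] := ltnP i a; last by rewrite /= insubN // -leqNgt.
rewrite (rowlenE p k (Ordinal ia)); case: i ia => [|i] ia.
  by rewrite (leq_trans (max_card _)) ?card_ord.
rewrite (rowlenE p k (Ordinal (ltnW ia))); apply/subset_leq_card/subsetP => j.
rewrite !inE => /leq_trans; apply; move/PP_monoP: pPP; apply.
by rewrite /northwest /= leqnSn leqnn.
Qed.

(** Necessity only tests the left neighbour, which fixes [j], and the upper one, which makes the
    previous row longer. In the top row the frame value [b] takes over. *)
Lemma addable_rowlen p k (i : 'I_a) (j : 'I_b) : p \in PP a b m ->
  addable p k.+1 (i, j) =
  (j == rowlen p k i.+1 :> nat) && (rowlen p k i.+1 < rowlen p k i)%N.
Proof.
move=> pPP; have ltn_rowlen' i' j' := ltn_rowlen k i' j' pPP.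
apply/addableP/andP => [[pij nwP]|[/eqP jE lt_mu]].
  have jl : (rowlen p k i.+1 <= j)%N by rewrite leqNgt ltn_rowlen' -leqNgt.
  have jE : j = rowlen p k i.+1 :> nat.
    apply/eqP; rewrite eqn_leq jl andbT.
    case E: (j : nat) => [|j1] //.
    have j1b : (j1 < b)%N by have := ltn_ord j; lia.
    rewrite (ltn_rowlen' i (Ordinal j1b)); apply: nwP; last first.
      by rewrite /northwest /= leqnn E leqnSn.
    by rewrite xpair_eqE -!val_eqE /=; lia.
  split; first exact/eqP.
  rewrite -jE; case E: (i : nat) => [|i1] /=; first exact: ltn_ord.
  have i1a : (i1 < a)%N by have := ltn_ord i; lia.
  have := ltn_rowlen' (Ordinal i1a) j; rewrite /= => ->; apply: nwP; last first.
    by rewrite /northwest /= leqnn E leqnSn.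
  by rewrite xpair_eqE -!val_eqE /=; lia.
split; first by rewrite ltnS leqNgt -ltn_rowlen' -jE ltnn.
move=> [i1 j1] ne; rewrite /northwest /= => /andP[le_i le_j].
rewrite -ltn_rowlen'; case: (ltngtP i1 i) le_i => // [lt_i _|/val_inj eq_i _].
  apply: leq_ltn_trans le_j _; rewrite jE; apply: leq_trans lt_mu _.
  suff mono n : (rowlen p k (i1.+1 + n) <= rowlen p k i1.+1)%N.
    by have := mono (i - i1.+1)%N; rewrite subnKC.
  by elim: n => [|n IH]; rewrite ?addn0 // addnS (leq_trans (rowlen_anti _ _ pPP)).
rewrite eq_i -jE ltn_neqAle le_j andbT.
by apply: contra ne => /eqP/val_inj->; rewrite eq_i.
Qed.

Lemma removable_rowlen p k (i : 'I_a) (j : 'I_b) : p \in PP a b m ->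
  removable p k (i, j) =
  (j.+1 == rowlen p k i.+1 :> nat) && (rowlen p k i.+2 < rowlen p k i.+1)%N.
Proof.
move=> pPP; have ltn_rowlen' i' j' := ltn_rowlen k i' j' pPP.
have mub i' : (rowlen p k i' <= b)%N.
  by elim: i' => // i' IH; apply: leq_trans (rowlen_anti _ _ pPP) IH.
apply/removableP/andP => [[pij seP]|[/eqP jE lt_mu]].
  have jl : (j < rowlen p k i.+1)%N by rewrite ltn_rowlen'.
  have jE : j.+1 = rowlen p k i.+1 :> nat.
    apply/eqP; rewrite eqn_leq jl andTb leqNgt; apply/negP => lt_j.
    have j1b : (j.+1 < b)%N by apply: leq_trans lt_j (mub _).
    move: lt_j; rewrite (ltn_rowlen' i (Ordinal j1b)); apply/negP; rewrite -leqNgt.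
    apply: seP; last by rewrite /northwest /= leqnn leqnSn.
    by rewrite xpair_eqE -!val_eqE /=; lia.
  split; first exact/eqP.
  rewrite -jE ltnS; have [ia|ai] := ltnP i.+1 a; last first.
    by rewrite /rowlen insubN // -leqNgt.
  rewrite leqNgt (ltn_rowlen' (Ordinal ia) j) -leqNgt; apply: seP.
    by rewrite xpair_eqE -!val_eqE /=; lia.
  by rewrite /northwest /= leqnn leqnSn.
split; first by rewrite -ltn_rowlen' -jE.
move=> [i1 j1] ne; rewrite /northwest /= => /andP[le_i le_j].
rewrite leqNgt -ltn_rowlen' -leqNgt.
case: (ltngtP i i1) le_i => // [lt_i _|/val_inj eq_i _].
  apply: leq_trans le_j; rewrite -ltnS jE; apply: leq_ltn_trans lt_mu.
  suff mono n : (rowlen p k (i.+2 + n) <= rowlen p k i.+2)%N.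
    by have := mono (i1 - i.+1)%N; rewrite addSn subnKC.
  by elim: n => [|n IH]; rewrite ?addn0 // addnS (leq_trans (rowlen_anti _ _ pPP)).
rewrite -eq_i -jE ltn_neqAle le_j andbT.
by apply: contra ne => /eqP/val_inj->; rewrite eq_i.
Qed.

Lemma corner_sum_PP (R : comPzRingType) (q : R) p k : p \in PP a b m ->
  \sum_(u | addable p k.+1 u) corner_wt q a b u.1 u.2 -
  \sum_(u | removable p k u) corner_wt q a b u.1.+1 u.2.+1 =
  (1 - q ^+ a) * (1 - q ^+ b).
Proof.
move=> pPP.
rewrite -(corner_sum q (erefl : rowlen p k 0 = b) (rowlen_last p k)); last first.
  by move=> i; apply: rowlen_anti.
rewrite !pair_big_dep /=; congr (_ - _); apply: eq_bigl => -[i j].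
  by rewrite addable_rowlen.
by rewrite removable_rowlen.
Qed.

(** * Barely set-valued plane partitions as addable boxes *)

Lemma leq_set_max_min (A B : {set 'I_m.+1}) : A != set0 -> B != set0 ->
  reflect {in A & B, forall x y : 'I_m.+1, (x <= y)%N} (set_max A <= set_min B)%N.
Proof.
move=> /set_maxP maxA /set_minP minB.
apply: (iffP idP) => [le_AB x1 y1 x1A y1B|]; last first.
  by case: maxA minB => [[x xA ->] _] [[y yB ->] _]; apply.
case: maxA minB => [_ maxP] [_ minP]; exact: leq_trans (maxP _ x1A) (leq_trans le_AB (minP _ y1B)).
Qed.

Lemma PP1P (t : {ffun box -> {set 'I_m.+1}}) :
  reflect
    [/\ forall u, t u != set0,
        exists2 u, #|t u| = 2 & forall v, v != u -> #|t v| = 1%N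
      & forall u v, u != v -> northwest u v ->
          {in t v & t u, forall x y : 'I_m.+1, (x <= y)%N}]
    (t \in PP1 a b m).
Proof.
rewrite inE; apply: (iffP and3P) => -[h1 h2 h3].
  have t0 u : t u != set0 by apply: (forallP h1).
  split=> // [|u v uv nw]; last first.
    apply/leq_set_max_min => //; have /forallP/(_ v)/implyP := forallP h3 u.
    by apply; rewrite uv.
  have /existsP[u /andP[/eqP tu /forallP tv]] := h2.
  by exists u => // v vu; apply/eqP/(implyP (tv v)).
split; first exact/forallP.
  case: h2 => u tu tv; apply/existsP; exists u; rewrite tu eqxx.
  by apply/forallP => v; apply/implyP => /tv ->.
apply/forallP => u; apply/forallP => v; apply/implyP => /andP[uv nw].
by apply/leq_set_max_min => //; apply: h3.
Qed.

(* Lowering the two-element set to its minimum makes its box addable at the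
   level of the maximum. *)
Definition set_valued (z : box * (filling * 'I_m.+1)) :
    {ffun box -> {set 'I_m.+1}} :=
  [ffun v => if v == z.1 then [set z.2.1 v; z.2.2] else [set z.2.1 v]].

Definition addable_triples : {set box * (filling * 'I_m.+1)} :=
  [set z : box * (filling * 'I_m.+1) |
     (z.2.1 \in PP a b m) && addable z.2.1 z.2.2 z.1].

Lemma set_valued_inj : {in addable_triples &, injective set_valued}.
Proof.
move=> [u [p y]] [u' [p' y']]; rewrite !inE /=.
move=> /andP[_ /addableP[lt_y _]] /andP[_ /addableP[lt_y' _]] /ffunP eq_t.
(* The box is recovered as the only one holding two elements. *)
have eq_u : u' = u.
  have := eq_t u; rewrite !ffunE eqxx /=; case: eqVneq => [->//|_].
  move/(congr1 (fun A : {set _} => #|A|)); rewrite cards1 cards2.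
  by rewrite -val_eqE /= neq_ltn lt_y.
rewrite {}eq_u in lt_y' eq_t *.
(* Since [p u < y] and [p' u < y'], equal pairs have equal minima and equal maxima. *)
have [eq_pu eq_y] : p u = p' u /\ y = y'.
  have := eq_t u; rewrite !ffunE eqxx => /setP eq_s.
  have := eq_s (p u); have := eq_s y; have := eq_s (p' u); have := eq_s y'.
  rewrite !inE !eqxx !orbT -!val_eqE /= => e1 e2 e3 e4.
  by split; apply: val_inj => /=; lia.
congr (_, (_, _)) => //; apply/ffunP => v; have [->//|vu] := eqVneq v u.
by have := eq_t v; rewrite !ffunE /= (negPf vu); apply: set1_inj.
Qed.

Lemma set_valued_PP1 z : z \in addable_triples -> set_valued z \in PP1 a b m.
Proof.
case: z => u [p y]; rewrite inE /= => /andP[/PP_monoP pp /addableP[lt_y le_y]].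
apply/PP1P; split=> [v||v w vw nw x1 y1].
- rewrite ffunE; apply/set0Pn; exists (p v).
  by case: ifP => _; rewrite !inE eqxx.
- exists u => [|v vu]; rewrite ffunE /= ?eqxx ?(negPf vu) ?cards1 // cards2.
  by rewrite -val_eqE /= neq_ltn lt_y.
have le_wv := pp _ _ nw; rewrite !ffunE /=.
have [wu|wu] := eqVneq w u; have [vu|vu] := eqVneq v u.
- by rewrite wu vu eqxx in vw.
- rewrite !inE => /orP[]/eqP-> /eqP-> //.
  by apply: le_y => //; rewrite -wu.
- rewrite !inE => /eqP-> /orP[]/eqP-> //.
  by apply: leq_trans le_wv _; rewrite vu ltnW.
- by rewrite !inE => /eqP-> /eqP->.
Qed.

Lemma set_valued_surj t : t \in PP1 a b m ->
  exists2 z, z \in addable_triples & t = set_valued z.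
Proof.
case/PP1P=> t0 [u tu tv] mono.
have [x [y [lt_xy tuE]]] : exists x y : 'I_m.+1, (x < y)%N /\ t u = [set x; y].
  have /eqP/cards2P[x [y [ne_xy tuE]]] := tu.
  have [lt_xy|lt_yx|/val_inj eq_xy] := ltngtP x y.
  - by exists x, y.
  - by exists y, x; rewrite setUC.
  - by rewrite eq_xy eqxx in ne_xy.
have pick_t v : exists z, z \in t v by apply/set0Pn.
pose p : filling := [ffun v => if v == u then x else xchoose (pick_t v)].
have p_t v : p v \in t v.
  by rewrite ffunE; have [->|_] := eqVneq; [rewrite tuE !inE eqxx | apply: xchooseP].
have tE v : v != u -> t v = [set p v].
  move=> vu; have /eqP/cards1P[z tz] := tv v vu.
  by have := p_t v; rewrite tz inE => /eqP->.
have pu : p u = x by rewrite ffunE eqxx.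
exists (u, (p, y)); last first.
  apply/ffunP => v; rewrite ffunE /=.
  by have [->|/tE//] := eqVneq; rewrite pu.
rewrite inE /=; apply/andP; split.
  apply/PP_monoP => v w nw; have [->//|vw] := eqVneq v w.
  exact: mono vw nw _ _ (p_t w) (p_t v).
apply/addableP; rewrite pu; split=> // v vu nw.
by apply: (mono _ _ vu nw _ _ _ (p_t v)); rewrite tuE !inE eqxx orbT.
Qed.

Lemma bsv_size_set_valued z : z \in addable_triples ->
  bsv_size (set_valued z) = (pp_size z.2.1 + z.2.2)%N.
Proof.
case: z => u [p y]; rewrite inE /= => /andP[_ /addableP[lt_y _]].
rewrite /bsv_size /pp_size (bigD1 u) //= [in RHS](bigD1 u) //= ffunE eqxx /=.
rewrite big_setU1 ?inE -?val_eqE /= ?neq_ltn ?lt_y // big_set1.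
rewrite (eq_bigr (fun v => p v : nat)); first by rewrite addnAC.
by move=> v vu; rewrite ffunE /= (negPf vu) big_set1.
Qed.

(** * Averaging the corner sum over all ideals *)

Lemma sum_PP1_addable (R : pzRingType) (q : R) :
  q * (\sum_(t in PP1 a b m) q ^+ (bsv_size t - 1)) =
  \sum_(u : box)
    \sum_(z : filling * 'I_m.+1 | (z.1 \in PP a b m) && addable z.1 z.2 u)
      q ^+ (pp_size z.1 + z.2).
Proof.
rewrite mulr_sumr (eq_bigr (fun t => q ^+ bsv_size t)) => [|t tP]; last first.
  by rewrite -exprS subn1 prednK // bsv_size_gt0.
have -> : PP1 a b m = set_valued @: addable_triples.
  apply/setP => t; apply/idP/imsetP => [/set_valued_surj[z]|[z zA ->]].
    by exists z.
  exact: set_valued_PP1.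
rewrite (big_imset _ set_valued_inj) /= pair_big_dep /=.
apply: eq_big => [z|z zA]; first by rewrite inE.
by rewrite bsv_size_set_valued.
Qed.

Lemma sum_PP1_qnumbers (R : comPzRingType) (q : R) :
  (1 - q) * (1 - q ^+ (a + b)) *
    (q * \sum_(t in PP1 a b m) q ^+ (bsv_size t - 1)) =
  (1 - q ^+ a) * (1 - q ^+ b) *
    (q * ((\sum_(k < m) q ^+ k) * \sum_(p in PP a b m) q ^+ pp_size p)).
Proof.
rewrite sum_PP1_addable [LHS]mulr_sumr.
pose wt (p : filling) k := q ^+ (pp_size p + k).
(* Level [0] is never addable and level [m] never removable. Pairing level [k.+1] with level [k]
   makes both refer to the ideal of entries above [k]. *)
pose Add u := \sum_(p in PP a b m) \sum_(k < m | addable p k.+1 u) wt p k.+1.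
pose Rem u := \sum_(p in PP a b m) \sum_(k < m | removable p k u) wt p k.
have AddE u : \sum_(z : filling * 'I_m.+1 | (z.1 \in PP a b m)
     && addable z.1 z.2 u) q ^+ (pp_size z.1 + z.2) = Add u.
  rewrite -(pair_big_dep _ (fun p (y : 'I_m.+1) => addable p y u)
             (fun p (y : 'I_m.+1) => wt p y)) /=.
  apply: eq_bigr => p _; rewrite big_mkcond big_ord_recl [RHS]big_mkcond /=.
  by rewrite add0r.
have RemE u : \sum_(z : filling * 'I_m.+1 | (z.1 \in PP a b m)
     && removable z.1 z.2 u) q ^+ (pp_size z.1 + z.2) = Rem u.
  rewrite -(pair_big_dep _ (fun p (y : 'I_m.+1) => removable p y u)
             (fun p (y : 'I_m.+1) => wt p y)) /=.
  apply: eq_bigr => p _; rewrite big_mkcond big_ord_recr [RHS]big_mkcond /=.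
  have -> : removable p m u = false.
    by rewrite /removable ltnNge -ltnS ltn_ord.
  by rewrite addr0.
(* The constant splits by [corner_wt_diag]; in its second half, detailed balance trades [Add u] for
   [Rem u]. *)
transitivity (\sum_(u : box) (corner_wt q a b u.1 u.2 * Add u
                - corner_wt q a b u.1.+1 u.2.+1 * (q * Rem u))).
  apply: eq_bigr => -[i j] _ /=.
  rewrite -(corner_wt_diag q (ltn_ord i) (ltn_ord j)) -RemE.
  by rewrite -sum_addable_removable AddE; ring.
(* Regrouping by ideal: the factor [q] raises the removal weight to [wt p k.+1], the weight of
   addition. *)
transitivity (\sum_(p in PP a b m) \sum_(k < m) wt p k.+1 *
   (\sum_(u | addable p k.+1 u) corner_wt q a b u.1 u.2 -
    \sum_(u | removable p k u) corner_wt q a b u.1.+1 u.2.+1)).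
  rewrite sumrB; under [RHS]eq_bigr do under eq_bigr do rewrite mulrBr.
  under [RHS]eq_bigr do rewrite sumrB.
  rewrite sumrB; congr (_ - _).
    under eq_bigr do rewrite mulr_sumr.
    rewrite exchange_big; apply: eq_bigr => p _ /=.
    under eq_bigr do rewrite mulr_sumr big_mkcond.
    rewrite exchange_big; apply: eq_bigr => k _ /=.
    rewrite mulr_sumr [RHS]big_mkcond; apply: eq_bigr => u _.
    by case: ifP => // _; rewrite mulrC.
  under eq_bigr do rewrite !mulr_sumr.
  rewrite exchange_big; apply: eq_bigr => p _ /=.
  under eq_bigr do rewrite !mulr_sumr big_mkcond.
  rewrite exchange_big; apply: eq_bigr => k _ /=.
  rewrite mulr_sumr [RHS]big_mkcond; apply: eq_bigr => u _.
  by case: ifP => // _; rewrite /wt addnS exprS mulrC.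
under eq_bigr => p pP do under eq_bigr do rewrite (corner_sum_PP q _ pP).
rewrite mulr_suml !mulr_sumr exchange_big; apply: eq_bigr => k _ /=.
rewrite !mulr_sumr; apply: eq_bigr => p _.
by rewrite /wt addnS exprS exprD; ring.
Qed.

End Corners.

(** * From powers of [q] to q-integers and fractions *)

Lemma qintE k : (1 - 'X) * qint k = 1 - 'X^k.
Proof. by rewrite -[1 - 'X^k]opprB subrX1 -mulNr opprB. Qed.

(** Its value at 1 is [k]. *)
Lemma qint_neq0 k : (0 < k)%N -> qint k != 0.
Proof.
move=> k0; apply/eqP => /(congr1 (fun P : {poly int} => P.[1])).
rewrite /qint horner_sum horner0 (eq_bigr (fun=> 1)) => [|i _]; last first.
  by rewrite hornerXn expr1n.
by rewrite sumr_const card_ord => /eqP; rewrite pnatr_eq0; lia.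
Qed.

(* The identity is stated in the field of fractions of Z[q], q = 'X. *)
Theorem theorem1p4 (a b m : nat)
  (ha : (1 <= a)%N) (hb : (1 <= b)%N) (hm : (1 <= m)%N) :
  (\sum_(t in PP1 a b m) 'X^(bsv_size t - 1) : {poly int})%:F =
  (qint a)%:F * (qint b)%:F / (qint (a + b))%:F * (qint m)%:F *
  (\sum_(p in PP a b m) 'X^(pp_size p) : {poly int})%:F
  :> {fraction {poly int}}.
Proof.
set S := \sum_(t in _) _; set Z := \sum_(p in _) _.
have qab0 : qint (a + b) != 0 by apply: qint_neq0; lia.
(* The factor to cancel: one [1 - 'X] for each of two q-integers on either side, and ['X] from the
   exponent shift. *)
have c0 : (1 - 'X) ^+ 2 * 'X != 0 :> {poly int}.
  rewrite mulf_neq0 ?expf_neq0 ?polyX_eq0 //.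
  by rewrite -oppr_eq0 opprB -polyC1 polyXsubC_eq0.
have SE : qint (a + b) * S = qint a * qint b * qint m * Z.
  apply: (mulfI c0); have := sum_PP1_qnumbers a b m ('X : {poly int}).
  rewrite -/S -/Z -/(qint m) -!qintE => E.
  transitivity ((1 - 'X) * ((1 - 'X) * qint (a + b)) * ('X * S)); first by ring.
  by rewrite E; ring.
have qF0 : (qint (a + b))%:F != 0 by rewrite tofrac_eq0.
have SF : (qint (a + b))%:F * S%:F
    = (qint a)%:F * (qint b)%:F * (qint m)%:F * Z%:F.
  by rewrite -[LHS]tofracM SE !tofracM.
move: qF0 SF; move: (_%:F) (S%:F) => x s x0 SF.
by rewrite -(mulKf x0 s) SF mulrCA -!mulrA; congr (_ * (_ * _)); rewrite mulrCA.
Qed.
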